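(* Let $\Phi$ be a finite crystallographic root system. For two $\Phi$-posets $R,S\subseteq\Phi$, the sets \[ R\wedge_{C} S=\mathrm{ncd}\Big(\mathrm{cl}(R^+\cup S^+)\sqcup (R^-\cap S^-)\Big) \quad\text{and}\quad R\vee_{C} S=\mathrm{pcd}\Big((R^+\cap S^+)\sqcup \mathrm{cl}(R^-\cup S^-)\Big) \] are antisymmetric (they are moreover closed, hence they are $\Phi$-posets). Consequently, the set $\mathrm{Pos}(\Phi)$ of all $\Phi$-posets induces a sublattice of the lattice of closed subsets of $\Phi$ under the weak order, i.e. the weak order on $\mathrm{Pos}(\Phi)$ is a lattice whose meet and join are $\wedge_C$ and $\vee_C$.
   Context: Let $V$ be a real Euclidean space with scalar product $\langle\cdot,\cdot\rangle$. For $\alpha\neq0$ let $\alpha^\vee=2\alpha/\langle\alpha,\alpha\rangle$ and $s_\alpha(v)=v-\langle\alpha^\vee,v\rangle\alpha$. A finite root system is a finite set $\Phi\subset V\setminus\{0\}$ with $\Phi\cap\mathbb{R}\alpha=\{\alpha,-\alpha\}$ and $s_\alpha\Phi=\Phi$ for all $\alpha\in\Phi$; it is crystallographic if $\langle\alpha^\vee,\beta\rangle\in\mathbb{Z}$ for all $\alpha,\beta\in\Phi$. Fix a generic linear functional $f$ and let $\Phi^+=\{\alpha\in\Phi: f(\alpha)>0\}$, $\Phi^-=\{\alpha\in\Phi:f(\alpha)<0\}$. For $R\subseteq\Phi$ write $R^+=R\cap\Phi^+$, $R^-=R\cap\Phi^-$. The weak order on subsets of $\Phi$ is: $R\le S$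 iff $R^+\supseteq S^+$ and $R^-\subseteq S^-$. A subset $R$ is antisymmetric if $R\cap -R=\varnothing$, and closed if $\alpha,\beta\in R$, $m,n\in\mathbb{N}$ and $m\alpha+n\beta\in\Phi$ imply $m\alpha+n\beta\in R$ (for crystallographic $\Phi$ this is equivalent to: $\alpha,\beta\in R$, $\alpha+\beta\in\Phi$ imply $\alpha+\beta\in R$). A $\Phi$-poset is an antisymmetric closed subset of $\Phi$. The closure of $R$ is $\mathrm{cl}(R)=\Phi\cap\mathbb{N}R$ (roots that are nonnegative integer combinations of elements of $R$). For $R\subseteq\Phi$ and finite $X\subseteq\Phi$ let $\Sigma X$ denote the sum of the elements of $X$, and define $\mathrm{ncd}(R)=R\setminus\{\alpha\in R^-:\exists X\subseteq R^+ \text{ with } \alpha+\Sigma X\in\Phi\setminus R\}$ and $\mathrm{pcd}(R)=R\setminus\{\alpha\in R^+:\exists X\subseteq R^- \text{ with } \alpha+\Sigma X\in\Phi\setminus R\}$.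
   Formalization: In ncd and pcd, X is taken as a finite multiset of elements of R^+ (resp. R^-), repetitions allowed, instead of a set: with sets, closedness fails in type B2 for R={a+b,a+2b}, S={a,a+b,a+2b,-b}, whose join would be {a+2b,-b}. *)

(* Defs.v *)
From mathcomp Require Export all_boot all_order all_algebra.
From mathcomp Require Export finmap.
From mathcomp Require Export boolp reals.

Set Implicit Arguments.
Unset Strict Implicit.
Unset Printing Implicit Defensive.

Import Order.TTheory GRing.Theory Num.Theory.

Local Open Scope fset_scope.
Local Open Scope ring_scope.

Section RootSystem.
Variables (R : realType) (V : vectType R) (dot : {dot V for idfun}).

Definition coroot (a : V) : V := (2 / dot a a) *: a.

Definition reflection (a v : V) : V := v - dot (coroot a) v *: a.

Record root_system (Phi : {fset V}) : Prop := RootSystem {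
  roots_neq0 : 0 \notin Phi;
  roots_line : forall a, a \in Phi ->
    forall v, (v \in Phi /\ exists c : R, v = c *: a) <-> (v = a \/ v = - a);
  roots_refl : forall a, a \in Phi -> [fset reflection a b | b in Phi] = Phi
}.

Definition crystallographic (Phi : {fset V}) : Prop :=
  forall a b, a \in Phi -> b \in Phi -> dot (coroot a) b \is a Num.int.

End RootSystem.

Section Posets.
Variables (R : realType) (V : vectType R).
Implicit Types (f : {scalar V}) (Phi A B : {fset V}).

Definition generic f Phi : Prop := forall a, a \in Phi -> f a != 0.

Definition fpos f A : {fset V} := [fset a in A | 0 < f a].
Definition fneg f A : {fset V} := [fset a in A | f a < 0].

Definition weak_le f A B : Prop :=
  fpos f B `<=` fpos f A /\ fneg f A `<=` fneg f B.

Definition antisym A : Prop := A `&` [fset - a | a in A] = fset0.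

Definition closed_in Phi A : Prop :=
  A `<=` Phi /\
  forall a b (m n : nat), a \in A -> b \in A ->
    a *+ m + b *+ n \in Phi -> a *+ m + b *+ n \in A.

Definition Phi_poset Phi A : Prop := closed_in Phi A /\ antisym A.

Definition cl Phi A : {fset V} :=
  [fset a in Phi | `[< exists c : V -> nat, a = \sum_(b <- A) b *+ c b >]].

(* The family X of summands is a finite multiset, i.e. it may repeat a root.
   If it were required to be duplicate-free, [ncd] and [pcd] would not preserve
   closedness: in type B2 with simple roots a (long) and b (short), for the
   closed antisymmetric sets {a+b, a+2b} and {a, a+b, a+2b, -b}, the set
   {a+b, a+2b, -b} would only lose a+b under [pcd], leaving {a+2b, -b}, whereas
   (a+2b) + 2(-b) = a lies outside it and forces a+2b to be removed as well. *)
Definition ncd f Phi A : {fset V} :=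
  A `\` [fset a in fneg f A |
    `[< exists2 X : seq V, {subset X <= fpos f A} &
          a + \sum_(x <- X) x \in Phi `\` A >]].

Definition pcd f Phi A : {fset V} :=
  A `\` [fset a in fpos f A |
    `[< exists2 X : seq V, {subset X <= fneg f A} &
          a + \sum_(x <- X) x \in Phi `\` A >]].

Definition meetC f Phi A B : {fset V} :=
  ncd f Phi (cl Phi (fpos f A `|` fpos f B) `|` (fneg f A `&` fneg f B)).

Definition joinC f Phi A B : {fset V} :=
  pcd f Phi ((fpos f A `&` fpos f B) `|` cl Phi (fneg f A `|` fneg f B)).

End Posets.

Section LatticeOn.
Variables (T : Type) (le : T -> T -> Prop) (meet join : T -> T -> T).

(* [P] carves out the carrier; [le], [meet] and [join] are only constrained on
   it, since the weak order is a partial order only on subsets of the root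
   system. *)
Record lattice_on (P : T -> Prop) : Prop := LatticeOn {
  lat_refl : forall x, P x -> le x x;
  lat_anti : forall x y, P x -> P y -> le x y -> le y x -> x = y;
  lat_trans : forall x y z, P x -> P y -> P z -> le x y -> le y z -> le x z;
  lat_meet_in : forall x y, P x -> P y -> P (meet x y);
  lat_meet_l : forall x y, P x -> P y -> le (meet x y) x;
  lat_meet_r : forall x y, P x -> P y -> le (meet x y) y;
  lat_meet_glb : forall x y z, P x -> P y -> P z ->
    le z x -> le z y -> le z (meet x y);
  lat_join_in : forall x y, P x -> P y -> P (join x y);
  lat_join_l : forall x y, P x -> P y -> le x (join x y);
  lat_join_r : forall x y, P x -> P y -> le y (join x y);
  lat_join_lub : forall x y z, P x -> P y -> P z ->
    le x z -> le y z -> le (join x y) z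
}.

Record sublattice_of (P Q : T -> Prop) : Prop := SublatticeOf {
  sublat_ambient : lattice_on Q;
  sublat_sub : forall x, P x -> Q x;
  sublat_meet : forall x y, P x -> P y -> P (meet x y);
  sublat_join : forall x y, P x -> P y -> P (join x y)
}.

End LatticeOn.

(* Main.v *)
(* The basic tool is that two roots with negative scalar product sum to a root or
   to 0. It yields that if c and c + (sum of X) are roots and X consists of positive
   roots, then X can be ordered so that all partial sums starting at c are roots
   or 0. Deletion preserves closedness because, along such an ordering, a sum
   (a + b) + (sum of X) splits into two roots or zeros a + (sum of Y) and
   b + (sum of Z), with X the union of Y and Z, while a chain that starts in a
   common closed lower bound of A and B enters the positive side inside A or B,
   which gives the universal property of the meet. Joins are the meets for the
   opposite functional. *)
Require Import Defs.
From mathcomp Require Import zify lra.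

Import Order.TTheory GRing.Theory Num.Theory.
(* [Order.TTheory] has lemmas named [meetC] and [joinC]. *)
Import Defs(meetC, joinC).

Set Implicit Arguments.
Unset Strict Implicit.
Unset Printing Implicit Defensive.

Local Open Scope fset_scope.
Local Open Scope ring_scope.

(** * Signs of scalar products with sums *)

Section DotProduct.
Variables (R : realType) (V : vectType R) (dot : {dot V for idfun}).

Lemma dotC u v : dot u v = dot v u.
Proof. by rewrite hermC expr0 mul1r. Qed.

Lemma dot_gt0 u : u != 0 -> 0 < dot u u.
Proof. exact: neq0_dnorm_gt0. Qed.

Lemma dot_sum_gt0 v (X : seq V) :
  0 < dot v (\sum_(x <- X) x) -> exists2 x, x \in X & 0 < dot v x.
Proof.
rewrite linear_sumr /= => sX.
have [/hasP[x xX vx]|/hasPn nX] := boolP (has (fun x => 0 < dot v x) X).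
  by exists x.
case/negP: (lt_geF sX); rewrite big_seq; apply: sumr_le0 => x /nX.
by rewrite -leNgt.
Qed.

Lemma dot_sum_lt0 v (X : seq V) :
  dot v (\sum_(x <- X) x) < 0 -> exists2 x, x \in X & dot v x < 0.
Proof.
rewrite -oppr_gt0 -linearNl => /dot_sum_gt0[x xX].
by rewrite linearNl oppr_gt0; exists x.
Qed.

End DotProduct.

(** * Sums of two or three roots *)

Section RootSums.
Variables (R : realType) (V : vectType R) (dot : {dot V for idfun}).
Variable Phi : {fset V}.
Hypotheses (HPhi : root_system dot Phi) (Hcryst : crystallographic dot Phi).
Implicit Types (a b c u v x : V) (X Y Z : seq V) (A : {fset V}).

Definition root0 : pred V := fun v => (v == 0) || (v \in Phi).

Lemma root_neq0 a : a \in Phi -> a != 0.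
Proof. by apply: contraTneq => ->; exact: roots_neq0 HPhi. Qed.

Lemma root_dot_gt0 a : a \in Phi -> 0 < dot a a.
Proof. by move/root_neq0/(dot_gt0 dot). Qed.

Lemma rootN a : a \in Phi -> - a \in Phi.
Proof. by move=> aP; have [_ /(_ (or_intror erefl))[]] := roots_line HPhi aP (- a). Qed.

Lemma root0N a : root0 a -> root0 (- a).
Proof. by rewrite /root0 oppr_eq0 => /orP[->//|/rootN ->]; rewrite orbT. Qed.

Lemma root_root0 a : a \in Phi -> root0 a.
Proof. by rewrite /root0 => ->; rewrite orbT. Qed.

Lemma reflection_root a b : a \in Phi -> b \in Phi -> reflection dot a b \in Phi.
Proof.
move=> aP bP; rewrite -[X in _ \in X](roots_refl HPhi aP).
by apply/imfsetP; exists b.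
Qed.

Lemma dot_coroot a b : dot (coroot dot a) b = 2 * dot a b / dot a a.
Proof. by rewrite linearZl_LR /= mulrAC. Qed.

Lemma reflectionDr a b :
  dot (coroot dot a) b = -1 -> reflection dot a b = b + a.
Proof. by rewrite /reflection => ->; rewrite scaleN1r opprK. Qed.

Lemma int_lt0 (x : R) : x \is a Num.int -> x < 0 -> x = -1 \/ x <= -2.
Proof.
move=> /intrP[n ->]; rewrite ltrz0 => n0.
have [->|n1] := eqVneq n (-1); [by left|right].
rewrite -[-2]/((- 2)%:~R) ler_int; lia.
Qed.

(* If neither reflection yields a + b then both Cartan integers are at most -2,
   which is the equality case of Cauchy-Schwarz, so that b = - a. *)
Lemma rootD a b : a \in Phi -> b \in Phi -> dot a b < 0 -> root0 (a + b).
Proof.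
move=> aP bP ab.
have aa := root_dot_gt0 aP; have bb := root_dot_gt0 bP.
have ca : dot (coroot dot a) b < 0.
  by rewrite dot_coroot pmulr_llt0 ?invr_gt0// pmulr_rlt0.
have cb : dot (coroot dot b) a < 0.
  by rewrite dot_coroot dotC pmulr_llt0 ?invr_gt0// pmulr_rlt0.
have [/reflectionDr ra|ca2] := int_lt0 (Hcryst aP bP) ca.
  by rewrite addrC -ra root_root0// reflection_root.
have [/reflectionDr rb|cb2] := int_lt0 (Hcryst bP aP) cb.
  by rewrite -rb root_root0// reflection_root.
move: ca2 cb2; rewrite !dot_coroot [dot b a]dotC !ler_pdivrMr//.
set p := dot a a in aa *; set q := dot b b in bb *; set r := dot a b in ab *.
move=> rp rq.
(* The two bounds read [r <= - p] and [r <= - q]; multiplied, they reverse Cauchy-Schwarz. *)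
have rpq : p * q <= r ^+ 2 by nra.
(* The squared norm of [w] is [p * (p * q - r ^+ 2)], which is not positive. *)
pose w := p *: b - r *: a.
have w0 : w = 0.
  apply/eqP; apply: contraT => /(dot_gt0 dot).
  rewrite /w linearBl/= !linearZl_LR/= !linearBr/= !linearZr_LR/=.
  rewrite [dot b a]dotC -/p -/q -/r => ww; nra.
have bE : b = (r / p) *: a.
  move/eqP: w0; rewrite subr_eq0 => /eqP w0.
  by rewrite mulrC -scalerA -w0 scalerA mulVf ?gt_eqF// scale1r.
have [/(_ (conj bP (ex_intro _ _ bE)))[ba|ba] _] := roots_line HPhi aP b.
  by move: ab aa; rewrite /r /p ba => /lt_trans h /h; rewrite ltxx.
by rewrite ba /root0 subrr eqxx.
Qed.

Lemma root0D a b : root0 a -> root0 b -> dot a b < 0 -> root0 (a + b).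
Proof.
move=> /orP[/eqP-> b0 _|aP]; first by rewrite add0r.
move=> /orP[/eqP-> _|bP]; first by rewrite addr0 root_root0.
exact: rootD.
Qed.

Lemma root0B a b : root0 a -> root0 b -> 0 < dot a b -> root0 (a - b).
Proof.
by move=> a0 b0 ab; apply: root0D; rewrite ?root0N// linearNr oppr_lt0.
Qed.

(* The root-theoretic shadow of the Jacobi identity. *)
Lemma root0_third a b x : root0 a -> root0 b -> root0 x ->
  root0 (a + b + x) -> a + b != 0 -> root0 (a + x) \/ root0 (b + x).
Proof.
move=> a0 b0 x0 c0 ab0.
have [/root0D ax|ax] := ltP (dot a x) 0; first by left; apply: ax.
have [/root0D bx|bx] := ltP (dot b x) 0; first by right; apply: bx.
have [/root0B ca|ca] := ltP 0 (dot (a + b + x) a).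
  by right; move: (ca c0 a0); rewrite -(addrA a) [_ - a]addrC addKr.
have [/root0B cb|cb] := ltP 0 (dot (a + b + x) b).
  by left; move: (cb c0 b0); rewrite addrAC addrK.
(* In the remaining case [a + b] has a nonnegative product with [x] and a nonpositive one with
   [a + b + x], so its squared norm cannot be positive. *)
have := dot_gt0 dot ab0; move: ca cb.
rewrite !(linearDl, linearDr)/= (dotC _ x a) (dotC _ x b) => *; lra.
Qed.

(** * Closedness under sums of two roots *)

Definition add_closed A : Prop := A `<=` Phi /\
  forall a b, a \in A -> b \in A -> a + b \in Phi -> a + b \in A.

Lemma sum_rem X x : x \in X -> \sum_(y <- X) y = x + \sum_(y <- rem x X) y.
Proof. by move=> xX; rewrite (perm_big _ (perm_to_rem xX)) big_cons. Qed.

(** A root [s] has positive product with itself, hence with some summand [x]. Then [s - x] is zero,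
    and [s = x], or a root, to which induction on the length applies. *)
Lemma add_closed_sum A X : add_closed A -> {subset X <= A} ->
  \sum_(x <- X) x \in Phi -> \sum_(x <- X) x \in A.
Proof.
move=> [AP Acl]; have [n] := ubnP (size X); elim: n X => // n IHn X.
rewrite ltnS => sX XA sP.
have [x xX sx] := dot_sum_gt0 (root_dot_gt0 sP).
have xA := XA x xX; have xP := fsubsetP AP x xA.
have := root0B (root_root0 sP) (root_root0 xP) sx.
have := sP; rewrite (sum_rem xX) [x + _]addrC addrK => sP' /orP[/eqP->|rP].
  by rewrite add0r.
apply: Acl => //; apply: IHn => //.
  by rewrite size_rem//; case: (X) xX sX.
by move=> y /mem_rem/XA.
Qed.

(** Coefficients equal to 1 give one direction. Conversely [a *+ m + b *+ n] is the sum of a list of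
    [m] copies of [a] and [n] copies of [b]. *)
Lemma closed_inP A : closed_in Phi A <-> add_closed A.
Proof.
split=> -[AP Acl]; split=> //.
  by move=> a b aA bA; have := Acl a b 1%N 1%N aA bA; rewrite !mulr1n.
move=> a b m n aA bA.
have -> : a *+ m + b *+ n = \sum_(x <- nseq m a ++ nseq n b) x.
  by rewrite big_cat !big_nseq/= !iter_addr_0.
apply: add_closed_sum => // x; rewrite mem_cat !mem_nseq.
by case/orP=> /andP[_ /eqP->].
Qed.


(** * Chains of partial sums *)

Lemma sum_fpos_gt0 (f : {scalar V}) A X :
  {subset X <= fpos f A} -> X != [::] -> 0 < f (\sum_(x <- X) x).
Proof.
case: X => // x X XA _; rewrite big_cons linearD /= ltr_wpDr//; last first.
  by have := XA x (mem_head _ _); rewrite !inE => /andP[].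
rewrite linear_sum big_seq sumr_ge0// => y yX; apply: ltW.
by have := XA y; rewrite inE yX orbT !inE => /(_ isT)/andP[].
Qed.

Lemma foldl_add c X : foldl +%R c X = c + \sum_(x <- X) x.
Proof.
elim: X c => [|x X IHX] c /=; first by rewrite big_nil addr0.
by rewrite IHX big_cons addrA.
Qed.

(** Let [s] be the sum of [X], nonzero by positivity when [X] is nonempty. If [dot c s < 0], some
    [x] has negative product with [c] and can be added first. Otherwise [c + s] has positive product
    with [s], so some [x] can be subtracted from [c + s] and is added last. *)
Lemma root0_chain (f : {scalar V}) c X : root0 c ->
    {subset X <= fpos f Phi} -> root0 (c + \sum_(x <- X) x) ->
  exists2 Y, perm_eq Y X & all root0 (scanl +%R c Y).
Proof.
have [n] := ubnP (size X); elim: n c X => // n IHn c X.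
rewrite ltnS => sX c0 XP s0.
have [->|Xn0] := eqVneq X [::]; first by exists [::].
have Xroot x : x \in X -> root0 x.
  by move/XP; rewrite !inE => /andP[/root_root0].
have d0 : \sum_(x <- X) x != 0.
  have := sum_fpos_gt0 XP Xn0.
  by apply: contraTneq => ->; rewrite linear0 ltxx.
have XPr x : {subset rem x X <= fpos f Phi} by move=> y /mem_rem/XP.
have sXr x : x \in X -> (size (rem x X) < n)%N.
  by move=> xX; rewrite size_rem//; case: (X) xX sX.
have [/dot_sum_lt0[x xX cx]|cd] := ltP (dot c (\sum_(x <- X) x)) 0.
  have [] := IHn (c + x) (rem x X) (sXr x xX) _ (XPr x).
  - by apply: root0D => //; exact: Xroot.
  - by rewrite -addrA -sum_rem.
  move=> Y YX Yr; exists (x :: Y).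
    by rewrite (perm_trans _ (_ : perm_eq (x :: rem x X) X)) ?perm_cons//
      perm_sym perm_to_rem.
  by rewrite /= Yr root0D// Xroot.
have /dot_sum_gt0[x xX sx] : 0 < dot (c + \sum_(x <- X) x) (\sum_(x <- X) x).
  by rewrite linearDl/= ltr_wpDl// dot_gt0.
have [//||Y YX Yr] := IHn c (rem x X) (sXr x xX) _ (XPr x).
  have := root0B s0 (Xroot x xX) sx.
  by rewrite (sum_rem xX) addrCA [x + _]addrC addrK.
have YX' : perm_eq (rcons Y x) X.
  rewrite perm_rcons (perm_trans _ (_ : perm_eq (x :: rem x X) X)) ?perm_cons//.
  by rewrite perm_sym perm_to_rem.
exists (rcons Y x) => //.
by rewrite scanl_rcons all_rcons Yr andbT foldl_add (perm_big _ YX').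
Qed.

(** Along the chain, [root0_third] lets each new [y] be added to one of the two running pieces [a]
    and [b], as long as [a + b] is nonzero. If [a + b] vanishes, the total is the sum of the
    remaining terms, which is the first alternative. *)
Lemma root0_chain_split a b Y : root0 a -> root0 b -> root0 (a + b) ->
    {subset Y <= Phi} -> all root0 (scanl +%R (a + b) Y) ->
  (exists2 Z, {subset Z <= Y} & a + b + \sum_(y <- Y) y = \sum_(z <- Z) z) \/
  exists Y1 Y2, [/\ {subset Y1 <= Y}, {subset Y2 <= Y},
    root0 (a + \sum_(y <- Y1) y), root0 (b + \sum_(y <- Y2) y) &
    \sum_(y <- Y1) y + \sum_(y <- Y2) y = \sum_(y <- Y) y].
Proof.
elim: Y a b => [|y Y IHY] a b a0 b0 ab0 YP /=.
  by move=> _; right; exists [::], [::]; rewrite !big_nil !addr0.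
move=> /andP[aby0 Yr].
have subY Z : {subset Z <= Y} -> {subset Z <= y :: Y}.
  by move=> ZY z /ZY; rewrite inE => ->; rewrite orbT.
have [ab|abn0] := eqVneq (a + b) 0.
  by left; exists (y :: Y) => //; rewrite ab add0r.
have y0 : root0 y by rewrite root_root0// YP// mem_head.
have YP' : {subset Y <= Phi} by move=> z zY; rewrite YP// inE zY orbT.
have subyY Z : {subset Z <= Y} -> {subset y :: Z <= y :: Y}.
  by move=> ZY z; rewrite !inE => /orP[->//|/ZY ->]; rewrite orbT.
have [ay0|by0] := root0_third a0 b0 y0 aby0 abn0.
- have [||[Z ZY e]|[Y1 [Y2 [Y1Y Y2Y a1 b2 e]]]] := IHY (a + y) b ay0 b0 _ YP'.
  + by rewrite addrAC.
  + by rewrite addrAC.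
  + by left; exists Z; rewrite ?big_cons -?e ?addrA 1?[a + b + y]addrAC//; exact: subY.
  + right; exists (y :: Y1), Y2; split; [exact: subyY|exact: subY| |by []|].
      by rewrite big_cons addrA.
    by rewrite !big_cons -addrA e.
- have [||[Z ZY e]|[Y1 [Y2 [Y1Y Y2Y a1 b2 e]]]] := IHY a (b + y) a0 by0 _ YP'.
  + by rewrite addrA.
  + by rewrite addrA.
  + by left; exists Z; rewrite ?big_cons -?e ?addrA//; exact: subY.
  + right; exists Y1, (y :: Y2); split; [exact: subY|exact: subyY|by []| |].
      by rewrite big_cons addrA.
    by rewrite !big_cons addrCA e.
Qed.

(** * The closure in terms of lists *)

Lemma sum_count_mem A X : {subset X <= A} ->
  \sum_(x <- X) x = \sum_(b <- A) b *+ count_mem b X.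
Proof.
elim: X => [|x X IHX] XA; first by rewrite big_nil big1_seq.
have xA : x \in A by rewrite XA ?mem_head.
rewrite big_cons IHX => [|y yX]; last by rewrite XA// inE yX orbT.
under [RHS]eq_bigr do rewrite /= mulrnDr.
rewrite big_split/=; congr (_ + _).
rewrite (bigD1_seq x) ?fset_uniq//= eqxx big1 ?addr0// => b.
by rewrite eq_sym => /negPf ->.
Qed.

(** A natural coefficient is the multiplicity of a root in a list, so the sum lemmas for lists apply
    to [cl]. *)
Lemma mem_cl A v : v \in cl Phi A <->
  v \in Phi /\ exists2 X, {subset X <= A} & v = \sum_(x <- X) x.
Proof.
rewrite !inE /=; split=> [/andP[vP /asboolP[c vE]]|[vP [X XA vE]]].
  split=> //; exists (flatten [seq nseq (c b) b | b <- A]).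
    move=> x /flattenP[s /mapP[b bA ->]]; rewrite mem_nseq.
    by case/andP=> _ /eqP ->.
  rewrite vE big_flatten big_map; apply: eq_bigr => b _.
  by rewrite big_nseq iter_addr_0.
rewrite vP; apply/asboolP; exists (fun b => count_mem b X).
by rewrite vE (sum_count_mem XA).
Qed.

End RootSums.

(** * Deletion of negative roots preserves closedness *)

Section NegativeClosedDeletion.
Variables (R : realType) (V : vectType R) (dot : {dot V for idfun}).
Variables (Phi : {fset V}) (f : {scalar V}).
Hypotheses (HPhi : root_system dot Phi) (Hcryst : crystallographic dot Phi).
Hypothesis Hgen : generic f Phi.
Implicit Types (a b v x : V) (X Y : seq V) (A B C M : {fset V}).

Lemma mem_fpos A v : (v \in fpos f A) = (v \in A) && (0 < f v).
Proof. by rewrite !inE. Qed.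

Lemma mem_fneg A v : (v \in fneg f A) = (v \in A) && (f v < 0).
Proof. by rewrite !inE. Qed.

Lemma fpos_sub A : {subset fpos f A <= A}.
Proof. by move=> v; rewrite mem_fpos => /andP[]. Qed.

Lemma fneg_sub A : {subset fneg f A <= A}.
Proof. by move=> v; rewrite mem_fneg => /andP[]. Qed.

Lemma fsubset_sign A v : A `<=` Phi -> v \in A ->
  v \in fpos f A \/ v \in fneg f A.
Proof.
move=> AP vA; have := Hgen (fsubsetP AP v vA).
by rewrite mem_fpos mem_fneg vA neq_lt => /orP[->|->]; [right|left].
Qed.

Lemma fneg_add_closed A : add_closed Phi A -> add_closed Phi (fneg f A).
Proof.
move=> [/fsubsetP AP Acl]; split; first by apply/fsubsetP => v /fneg_sub/AP.
move=> a b; rewrite !mem_fneg => /andP[aA fa] /andP[bA fb] abP.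
by rewrite Acl// linearD -oppr_gt0 opprD addr_gt0 ?oppr_gt0.
Qed.

(** The deletion condition read contrapositively; this survival test is the form used below. *)
Lemma mem_fneg_ncd M v : v \in fneg f (ncd f Phi M) <->
  v \in fneg f M /\ forall X, {subset X <= fpos f M} ->
    v + \sum_(x <- X) x \in Phi -> v + \sum_(x <- X) x \in M.
Proof.
rewrite !mem_fneg 2!in_fsetE !inE /= -andbA; split.
  move=> /and3P[vN vM fv]; rewrite vM fv; split=> // X XM vXP.
  apply: contraNT vN => vXM; rewrite vM fv/=; apply/asboolP.
  by exists X => //; rewrite in_fsetD vXP vXM.
move=> [/andP[vM fv] H]; rewrite vM fv !andbT/=.
apply/asboolPn => -[X XM]; rewrite in_fsetD => /andP[/negP nM vP].
by apply: nM; exact: H.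
Qed.

Lemma fpos_ncd M : fpos f (ncd f Phi M) = fpos f M.
Proof.
apply/fsetP => v; rewrite !mem_fpos !inE /=.
by case: (ltP 0 (f v)) => [/lt_gtF ->|]; rewrite ?andbF// !andbT.
Qed.

Lemma ncd_sub M : {subset ncd f Phi M <= M}.
Proof. by move=> v; rewrite inE => /andP[]. Qed.

(** The cases follow the signs of the two roots. Two positive roots are handled by closedness of the
    positive part, which deletion leaves intact; only two negative roots require chains. *)
Lemma ncd_add_closed M : M `<=` Phi ->
  add_closed Phi (fpos f M) -> add_closed Phi (fneg f M) ->
  add_closed Phi (ncd f Phi M).
Proof.
move=> MP Pcl Ncl; set D := ncd f Phi M.
have DP : D `<=` Phi.
  by apply/fsubsetP => v /ncd_sub; exact: fsubsetP MP v.
have PD v : v \in fpos f M -> v \in D.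
  by rewrite -fpos_ncd; exact: fpos_sub.
(* Prepending [a] to a test list for [a + b] gives a test list for [b], so the survival of [b]
   passes on. *)
have mixed a b : a \in fpos f M -> b \in fneg f D -> a + b \in Phi ->
    a + b \in D.
  move=> aP /mem_fneg_ncd[bN Hb] abP.
  have sumE X : a + b + \sum_(x <- X) x = b + \sum_(x <- a :: X) x.
    by rewrite big_cons addrA [b + a]addrC.
  have subP X : {subset X <= fpos f M} -> {subset a :: X <= fpos f M}.
    by move=> XM x; rewrite inE => /orP[/eqP->|/XM].
  have abM : a + b \in M.
    have := Hb [:: a]; rewrite big_seq1 addrC; apply=> //.
    by move=> x; rewrite inE => /eqP->.
  have [/PD //|abN] := fsubset_sign MP abM.
  apply: fneg_sub; apply/mem_fneg_ncd; split=> // X /subP XM.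
  by rewrite sumE; exact: Hb.
have negative a b : a \in fneg f D -> b \in fneg f D -> a + b \in Phi ->
    a + b \in D.
  move=> /mem_fneg_ncd[aN Ha] /mem_fneg_ncd[bN Hb] abP.
  have abN : a + b \in fneg f M by apply: Ncl.2.
  apply: fneg_sub; apply/mem_fneg_ncd; split=> // X XM sP.
  have Nroot v : v \in fneg f M -> root0 Phi v.
    by move=> vN; apply: root_root0; exact: fsubsetP Ncl.1 v vN.
  have XP : {subset X <= fpos f Phi}.
    move=> x /XM; rewrite !mem_fpos => /andP[xM ->].
    by rewrite (fsubsetP MP).
  have [Y YX Yr] := root0_chain HPhi Hcryst (Nroot _ abN) XP (root_root0 sP).
  have YM : {subset Y <= fpos f M} by move=> y; rewrite (perm_mem YX) => /XM.
  have YP : {subset Y <= Phi} by move=> y /YM/fpos_sub; exact: fsubsetP MP y.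
  rewrite -(perm_big _ YX)/= in sP *.
  have consM u Z : u \in fpos f M -> {subset Z <= Y} ->
      {subset u :: Z <= fpos f M}.
    by move=> uM ZY z; rewrite inE => /orP[/eqP->|/ZY/YM].
  (* If the chain meets zero, the total is a sum of positive members of [M], whose set is closed. *)
  have [[Z ZY e]|] :=
    root0_chain_split HPhi Hcryst (Nroot _ aN) (Nroot _ bN) (Nroot _ abN) YP Yr.
    rewrite e in sP *; apply: fpos_sub.
    by apply: (add_closed_sum HPhi Hcryst Pcl) => // z /ZY/YM.
  move=> [Y1 [Y2 [Y1Y Y2Y u0 w0 e]]].
  have sE : a + b + \sum_(y <- Y) y =
      (a + \sum_(y <- Y1) y) + (b + \sum_(y <- Y2) y).
    by rewrite -e addrACA.
  have YM1 : {subset Y1 <= fpos f M} by move=> y /Y1Y/YM.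
  have YM2 : {subset Y2 <= fpos f M} by move=> y /Y2Y/YM.
  have uw : a + \sum_(y <- Y1) y + (b + \sum_(y <- Y2) y) \in Phi.
    by rewrite -sE.
  rewrite sE {sE sP}; set u := a + _ in u0 uw *; set w := b + _ in w0 uw *.
  (* If one piece is zero, the total is the other piece, to which the survival of [b] or of [a]
     applies. *)
  have [uE|un0] := eqVneq u 0.
    by move: uw; rewrite uE add0r; exact: Hb.
  have [wE|wn0] := eqVneq w 0.
    by move: uw; rewrite wE addr0; exact: Ha.
  have uM : u \in M by apply: Ha => //; move: u0; rewrite /root0 (negPf un0).
  have wM : w \in M by apply: Hb => //; move: w0; rewrite /root0 (negPf wn0).
  (* A positive piece is moved into the list added to the other starting root, whose survival then
     applies. Two negative pieces are handled by closedness of the negative part. *)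
  have [uP|uN] := fsubset_sign MP uM; last first.
    have [wP|wN] := fsubset_sign MP wM; last first.
      by apply: fneg_sub; exact: Ncl.2.
    move: uw; have -> : u + w = a + \sum_(y <- w :: Y1) y.
      by rewrite big_cons /u addrAC -addrA.
    by apply: Ha; exact: consM.
  move: uw; have -> : u + w = b + \sum_(y <- u :: Y2) y.
    by rewrite big_cons /w addrCA.
  by apply: Hb; exact: consM.
split=> // a b aD bD abP.
have [aP|aN] := fsubset_sign DP aD; have [bP|bN] := fsubset_sign DP bD.
- rewrite fpos_ncd in aP bP; apply: PD; exact: Pcl.2.
- by rewrite fpos_ncd in aP; exact: mixed.
- by rewrite fpos_ncd in bP; rewrite addrC mixed// addrC.
- exact: negative.
Qed.

(** * Properties of the closure *)

Lemma cl_sub A : {subset cl Phi A <= Phi}.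
Proof. by move=> v /mem_cl[]. Qed.

Lemma sub_cl A v : v \in A -> v \in Phi -> v \in cl Phi A.
Proof.
move=> vA vP; apply/mem_cl; split=> //; exists [:: v]; rewrite ?big_seq1//.
by move=> x; rewrite inE => /eqP->.
Qed.

Lemma cl_add_closed A : add_closed Phi (cl Phi A).
Proof.
split; first by apply/fsubsetP; exact: cl_sub.
move=> a b /mem_cl[_ [X XA ->]] /mem_cl[_ [Y YA ->]] abP.
apply/mem_cl; split=> //; exists (X ++ Y); rewrite ?big_cat//.
by move=> x; rewrite mem_cat => /orP[/XA|/YA].
Qed.

(** Test lists drawn from a closure can thus be replaced by lists of generators. *)
Lemma sum_cl A X : {subset X <= cl Phi A} ->
  exists2 Y : seq V, {subset Y <= A} & \sum_(x <- X) x = \sum_(y <- Y) y.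
Proof.
elim: X => [|x X IHX] XA; first by exists [::].
have [y yX|Y YA XE] := IHX; first by rewrite XA// inE yX orbT.
have /mem_cl[_ [Z ZA xE]] := XA x (mem_head _ _).
exists (Z ++ Y); last by rewrite big_cons big_cat XE xE.
by move=> y; rewrite mem_cat => /orP[/ZA|/YA].
Qed.

(** * The meet of two closed sets *)

Section Meet.
Variables A B : {fset V}.
Hypotheses (Acl : add_closed Phi A) (Bcl : add_closed Phi B).

Let P := fpos f A `|` fpos f B.
Let N := fneg f A `&` fneg f B.
Let M := cl Phi P `|` N.

Let P_fpos : {subset P <= fpos f Phi}.
Proof.
move=> v; rewrite in_fsetU !mem_fpos => /orP[]/andP[vA ->]; rewrite andbT.
  exact: fsubsetP Acl.1 v vA.
exact: fsubsetP Bcl.1 v vA.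
Qed.

Let cl_P_gt0 v : v \in cl Phi P -> 0 < f v.
Proof.
move=> /mem_cl[vP [X XP vE]]; rewrite vE.
apply: (@sum_fpos_gt0 _ _ f Phi) => [x /XP/P_fpos //|].
by apply: contraTneq vP => X0; rewrite vE X0 big_nil (roots_neq0 HPhi).
Qed.

Let M_sub : M `<=` Phi.
Proof.
apply/fsubsetP => v; rewrite in_fsetU => /orP[/cl_sub //|].
by rewrite in_fsetI => /andP[/fneg_sub + _]; exact: fsubsetP Acl.1 v.
Qed.

(** Closing a set of positive roots creates no negative root, so signs split [M] into its two
    defining pieces. *)
Let fpos_M : fpos f M = cl Phi P.
Proof.
apply/fsetP => v; rewrite mem_fpos in_fsetU in_fsetI !mem_fneg.
apply/andP/idP => [[/orP[//|]]|vP]; last by rewrite vP cl_P_gt0.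
by move=> /andP[/andP[_ /lt_gtF ->]].
Qed.

Let fneg_M : fneg f M = N.
Proof.
apply/fsetP => v; rewrite mem_fneg in_fsetU in_fsetI !mem_fneg.
apply/andP/idP => [[/orP[/cl_P_gt0/lt_gtF->|]] //|vN].
by rewrite vN orbT; case/andP: vN => /andP[].
Qed.

Lemma meetC_add_closed : add_closed Phi (meetC f Phi A B).
Proof.
apply: ncd_add_closed; [exact: M_sub| |].
  by rewrite fpos_M; exact: cl_add_closed.
rewrite fneg_M; split.
  apply/fsubsetP => v; rewrite in_fsetI => /andP[/fneg_sub + _].
  exact: fsubsetP Acl.1 v.
move=> a b; rewrite !in_fsetI => /andP[aA aB] /andP[bA bB] abP.
by rewrite (fneg_add_closed Acl).2// (fneg_add_closed Bcl).2.
Qed.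

(* If v = x + (the other summands) is in the closure of the positive part and
   - v survives in the negative part, then - x = - v + (the other summands) must
   lie in both A and B, one of which also contains x. *)
Lemma meetC_antisym : antisym A -> antisym B -> antisym (meetC f Phi A B).
Proof.
have antisymP E v : antisym E -> v \in E -> - v \in E -> False.
  move=> /fsetP/(_ v) + vE NvE.
  by rewrite in_fsetI vE in_fset0/= => /negbT/imfsetP[]; exists (- v); rewrite ?opprK.
move=> Aanti Banti; have Dcl := meetC_add_closed; set D := meetC f Phi A B in Dcl *.
have main v : v \in fpos f D -> - v \in D -> False.
  move=> vD NvD; have vn : - v \in fneg f D.
    by rewrite mem_fneg NvD linearN oppr_lt0; move: vD; rewrite mem_fpos => /andP[].
  move: vD vn; rewrite /D /meetC fpos_ncd fpos_M => /mem_cl[vP [X XP vE]].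
  move=> /mem_fneg_ncd[_ H].
  have [x xX] : exists x, x \in X.
    case: X vE {XP H} => [|x X _]; last by exists x; rewrite mem_head.
    by rewrite big_nil => v0; move: vP; rewrite v0 (negPf (roots_neq0 HPhi)).
  have xP := XP x xX; have := P_fpos xP; rewrite mem_fpos => /andP[xR fx].
  have : - x \in fneg f M.
    rewrite mem_fneg linearN oppr_lt0 fx andbT.
    have -> : - x = - v + \sum_(y <- rem x X) y.
      by rewrite vE (sum_rem xX) opprD addrNK.
    apply: H => [y /mem_rem/XP yP|].
      by rewrite fpos_M sub_cl//; move/P_fpos: yP => /fpos_sub.
    by rewrite vE (sum_rem xX) opprD addrNK (rootN HPhi).
  rewrite fneg_M in_fsetI => /andP[/fneg_sub NxA /fneg_sub NxB].
  by move: xP; rewrite in_fsetU => /orP[]/fpos_sub xE;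
    [exact: antisymP NxA|exact: antisymP NxB].
apply/fsetP => v; rewrite in_fsetI in_fset0; apply/negP => /andP[vD].
move=> /imfsetP[w /= wD vE].
have NvD : - v \in D by rewrite vE opprK.
have [vp|vn] := fsubset_sign Dcl.1 vD; first exact: main vp NvD.
apply: (main (- v)); rewrite ?opprK// mem_fpos NvD linearN oppr_gt0.
by move: vn; rewrite mem_fneg => /andP[].
Qed.

Lemma meetC_le_l : weak_le f (meetC f Phi A B) A.
Proof.
split; apply/fsubsetP => v.
  rewrite fpos_ncd fpos_M => vA; apply: sub_cl; first by rewrite in_fsetU vA.
  by move/fpos_sub: vA; exact: fsubsetP Acl.1 v.
by move=> /mem_fneg_ncd[]; rewrite fneg_M in_fsetI => /andP[].
Qed.

(** On the positive side, [C] contains the generators [P] and hence their closure. On the negative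
    side, a root of [C] must survive deletion, which is checked along a chain starting at that
    root. *)
Lemma meetC_glb C : add_closed Phi C ->
  weak_le f C A -> weak_le f C B -> weak_le f C (meetC f Phi A B).
Proof.
move=> Ccl [/fsubsetP CA1 /fsubsetP CA2] [/fsubsetP CB1 /fsubsetP CB2].
have PC : {subset P <= C}.
  by move=> v; rewrite in_fsetU => /orP[/CA1|/CB1]; exact: fpos_sub.
have clC : {subset cl Phi P <= C}.
  move=> v /mem_cl[vP [X XP vE]]; rewrite vE in vP *.
  by apply: (add_closed_sum HPhi Hcryst Ccl) => // x /XP/PC.
split; apply/fsubsetP => v.
  by rewrite fpos_ncd fpos_M mem_fpos => vP; rewrite clC// cl_P_gt0.
move=> vC; have vN : v \in fneg f M by rewrite fneg_M in_fsetI CA2 ?CB2.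
apply/mem_fneg_ncd; split=> // X; rewrite fpos_M => XP sP.
(* With generators as summands, each step of the chain adds a root of [A] or of [B]; this is lost
   for arbitrary members of the closure. *)
have [X' XP' XE] := sum_cl XP; rewrite {}XE {XP} in sP *.
have NM u : u \in fneg f C -> u \in M.
  by move=> uC; rewrite in_fsetU in_fsetI CA2// CB2// orbT.
(* The invariant of the chain. At the end the sum is a root, which excludes zero, and both other
   cases lie in [M]. *)
pose good u := [|| u == 0, u \in fneg f C | u \in cl Phi P].
have good_step c y : good c -> y \in P -> root0 Phi (c + y) -> good (c + y).
  rewrite /good => cg yP cy0; have yR := fpos_sub (P_fpos yP).
  have ycl : y \in cl Phi P by rewrite sub_cl.
  have [//|cyn0/=] := eqVneq (c + y) 0.
  have cyR : c + y \in Phi by move: cy0; rewrite /root0 (negPf cyn0).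
  have [/eqP->|cC|ccl] := or3P cg; first by rewrite add0r ycl orbT.
    have cyC : c + y \in C by apply: Ccl.2 => //; [exact: fneg_sub cC|exact: PC].
    have [cyp|->//] := fsubset_sign Ccl.1 cyC.
    have fcy : 0 < f (c + y) by move: cyp; rewrite mem_fpos => /andP[].
    (* Crossing to the positive side: the negative root [c] of [C] lies in both [A] and [B], and [y]
       in one of them, so closedness of that one makes [c + y] a generator. *)
    rewrite sub_cl ?orbT// in_fsetU !mem_fpos fcy !andbT.
    move: yP; rewrite in_fsetU => /orP[]/fpos_sub yE.
      by rewrite Acl.2//; exact: fneg_sub (CA2 _ cC).
    by rewrite Bcl.2 ?orbT//; exact: fneg_sub (CB2 _ cC).
  by rewrite (cl_add_closed P).2// orbT.
have good_chain Y c : {subset Y <= P} -> good c ->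
    all (root0 Phi) (scanl +%R c Y) -> good (c + \sum_(y <- Y) y).
  elim: Y c => [|y Y IHY] c YP cg /=; first by rewrite big_nil addr0.
  move=> /andP[cy0 Yr]; rewrite big_cons addrA IHY//.
    by move=> z zY; rewrite YP// inE zY orbT.
  by rewrite good_step// YP// mem_head.
have v0 : root0 Phi v by rewrite root_root0// (fsubsetP Ccl.1)//; exact: fneg_sub vC.
have [|Y YX Yr] :=
  root0_chain HPhi Hcryst (f := f) v0 _ (root_root0 sP).
  by move=> x /XP'/P_fpos.
rewrite -(perm_big _ YX)/= in sP *.
have : good (v + \sum_(y <- Y) y).
  apply: good_chain => //; first by move=> y; rewrite (perm_mem YX) => /XP'.
  by rewrite /good vC orbT.
rewrite /good (negPf (root_neq0 HPhi sP))/= => /orP[/NM //|sPcl].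
by rewrite in_fsetU sPcl.
Qed.

End Meet.

End NegativeClosedDeletion.

(** * Duality under negation of the functional, and antisymmetry of the order *)

Section Lattice.
Variables (R : realType) (V : vectType R).
Implicit Types (f : {scalar V}) (Phi A B C : {fset V}).

Lemma meetC_comm f Phi A B : meetC f Phi A B = meetC f Phi B A.
Proof. by rewrite /meetC (fsetUC (fpos f A)) (fsetIC (fneg f A)). Qed.

Lemma fposN f A : fpos (\- f) A = fneg f A.
Proof. by apply/fsetP => v; rewrite !inE/= oppr_gt0. Qed.

Lemma fnegN f A : fneg (\- f) A = fpos f A.
Proof. by apply/fsetP => v; rewrite !inE/= oppr_lt0. Qed.

(** Negating [f] exchanges positive and negative roots, hence [pcd] and [ncd]; facts about joins
    then follow from those about meets. *)
Lemma joinCN f Phi A B : joinC f Phi A B = meetC (\- f) Phi A B.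
Proof. by rewrite /joinC /pcd /meetC /ncd !fposN !fnegN fsetUC. Qed.

Lemma weak_leN f A B : weak_le (\- f) A B <-> weak_le f B A.
Proof. by rewrite /weak_le !fposN !fnegN; split=> -[]. Qed.

Lemma genericN f Phi : generic f Phi -> generic (\- f) Phi.
Proof. by move=> Hgen a /Hgen; rewrite oppr_eq0. Qed.

(** By genericity every root has a sign, so a set of roots is determined by its two signed parts. *)
Lemma weak_le_anti f Phi A B : generic f Phi -> A `<=` Phi -> B `<=` Phi ->
  weak_le f A B -> weak_le f B A -> A = B.
Proof.
move=> Hgen AP BP.
have sub C D : C `<=` Phi -> weak_le f C D -> weak_le f D C -> {subset C <= D}.
  move=> CP [_ /fsubsetP CD] [/fsubsetP DC _] v /(fsubset_sign Hgen CP).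
  by case=> [/DC/fpos_sub|/CD/fneg_sub].
by move=> AB BA; apply/fsetP => v; apply/idP/idP; exact: sub.
Qed.

End Lattice.

(** * The lattice of closed sets and its sublattice of posets *)

Section MeetJoin.
Variables (R : realType) (V : vectType R) (dot : {dot V for idfun}).
Variables (Phi : {fset V}) (f : {scalar V}).
Hypotheses (HPhi : root_system dot Phi) (Hcryst : crystallographic dot Phi).
Hypothesis Hgen : generic f Phi.

Lemma closed_lattice :
  lattice_on (weak_le f) (meetC f Phi) (joinC f Phi) (closed_in Phi).
Proof.
have closedP A := closed_inP HPhi Hcryst A; have HgenN := genericN Hgen.
split=> [A _|A B [AP _] [BP _]|A B C _ _ _ [AB1 AB2] [BC1 BC2]||||||||].
- by split.
- exact: weak_le_anti Hgen AP BP.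
- by split; [exact: fsubset_trans BC1 AB1|exact: fsubset_trans AB2 BC2].
- by move=> A B /closedP Acl /closedP Bcl; apply/closedP/(meetC_add_closed HPhi).
- by move=> A B /closedP Acl /closedP Bcl; exact (meetC_le_l f HPhi Acl Bcl).
- move=> A B /closedP Acl /closedP Bcl; rewrite meetC_comm.
  exact (meetC_le_l f HPhi Bcl Acl).
- move=> A B C /closedP Acl /closedP Bcl /closedP Ccl.
  exact (meetC_glb HPhi Hcryst Hgen Acl Bcl Ccl).
(* From here on, the join axioms are the meet axioms for [\- f], whose weak order is the reverse
   one. *)
- move=> A B /closedP Acl /closedP Bcl; rewrite joinCN.
  by apply/closedP/(meetC_add_closed HPhi).
- move=> A B /closedP Acl /closedP Bcl; rewrite joinCN.
  exact ((weak_leN f _ _).1 (meetC_le_l (\- f) HPhi Acl Bcl)).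
- move=> A B /closedP Acl /closedP Bcl; rewrite joinCN meetC_comm.
  exact ((weak_leN f _ _).1 (meetC_le_l (\- f) HPhi Bcl Acl)).
- move=> A B C /closedP Acl /closedP Bcl /closedP Ccl.
  move=> /(weak_leN f _ _).2 AC /(weak_leN f _ _).2 BC; rewrite joinCN.
  apply: (weak_leN f _ _).1.
  exact (meetC_glb HPhi Hcryst HgenN Acl Bcl Ccl AC BC).
Qed.

Lemma meetC_poset A B :
  Phi_poset Phi A -> Phi_poset Phi B -> Phi_poset Phi (meetC f Phi A B).
Proof.
have closedP A' := closed_inP HPhi Hcryst A'.
move=> [Acl Aanti] [Bcl Banti]; split; first exact: lat_meet_in closed_lattice _ _ _ _.
by apply: (meetC_antisym HPhi) => //; exact/closedP.
Qed.

End MeetJoin.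

Lemma joinC_poset (R : realType) (V : vectType R) (dot : {dot V for idfun})
    (Phi : {fset V}) (f : {scalar V}) (A B : {fset V}) :
  root_system dot Phi -> crystallographic dot Phi -> generic f Phi ->
  Phi_poset Phi A -> Phi_poset Phi B -> Phi_poset Phi (joinC f Phi A B).
Proof.
move=> HPhi Hcryst Hgen; rewrite joinCN.
exact: (meetC_poset HPhi Hcryst (genericN Hgen)).
Qed.

(** The order axioms and universal properties quantify over all members of the carrier, so they
    restrict to any part stable under both operations. *)
Lemma sublattice_lattice (T : Type) (le : T -> T -> Prop)
    (meet join : T -> T -> T) (P Q : T -> Prop) :
  sublattice_of le meet join P Q -> lattice_on le meet join P.
Proof.
case=> -[refl anti trans _ ml mr glb _ jl jr lub] PQ meetP joinP.
by split; eauto.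
Qed.

Theorem theorem3p17 (R : realType) (V : vectType R)
    (dot : {dot V for idfun}%R) (Phi : {fset V}) (f : {scalar V}%R)
    (HPhi : root_system dot Phi) (Hcryst : crystallographic dot Phi)
    (Hgen : generic f Phi) :
  [/\ forall A B : {fset V}, Phi_poset Phi A -> Phi_poset Phi B ->
        [/\ antisym (meetC f Phi A B), antisym (joinC f Phi A B),
            closed_in Phi (meetC f Phi A B) & closed_in Phi (joinC f Phi A B)],
      sublattice_of (weak_le f) (meetC f Phi) (joinC f Phi)
        (Phi_poset Phi) (closed_in Phi)
    & lattice_on (weak_le f) (meetC f Phi) (joinC f Phi) (Phi_poset Phi)].
Proof.
have L := closed_lattice HPhi Hcryst Hgen.
have meet_in := meetC_poset HPhi Hcryst Hgen.
have join_in A B := @joinC_poset _ _ _ _ _ A B HPhi Hcryst Hgen.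
have sub A : Phi_poset Phi A -> closed_in Phi A by case.
have sublattice : sublattice_of (weak_le f) (meetC f Phi) (joinC f Phi)
  (Phi_poset Phi) (closed_in Phi) by split.
split=> //; last exact: sublattice_lattice sublattice.
move=> A B PA PB.
by have [? ?] := meet_in A B PA PB; have [? ?] := join_in A B PA PB.
Qed.
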